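(* Let $f(u,v):\mathbb{R}^2\to\mathbb{H}^3_1$ be an isometric immersion of $\mathbb{L}^2$ into $\mathbb{H}^3_1$, where $(u,v)$ are global characteristic parameters of $f$. Let $N(u,v):\mathbb{R}^2\to\mathbb{S}^3_2$ denote its unit normal, and assume that $f(0,0)=1$ and $N(0,0)=j$. Then $$f(u,v)=a_1(u)\,a_2(v),\qquad N(u,v)=a_1(u)\,j\,a_2(v),$$ for $a_1(u):=f(u,0)$ and $a_2(v):=f(0,v)$. Moreover, these two asymptotic curves verify $$\langle a_1'(u),a_1(u)\,j\rangle=0=\langle a_2'(v),j\,a_2(v)\rangle.$$
   Context: $\mathbb{L}^2$ is $\mathbb{R}^2$ with the metric $-dx^2+dy^2$. $\mathbb{R}^4_2$ is $\mathbb{R}^4$ with the metric $\langle\ ,\ \rangle=-dx_0^2-dx_1^2+dx_2^2+dx_3^2$, identified with the associative algebra $\{x_0+x_1i+x_2j+x_3k\}$ with unit $1$ and products $i^2=-1$, $j^2=k^2=1$, $ij=k$, $ji=-k$, $ik=-j$, $ki=j$, $jk=-i$, $kj=i$. The anti-de Sitter space is $\mathbb{H}^3_1=\{z\in\mathbb{R}^4_2:\langle z,z\rangle=-1\}$, a Lie group under this product, and $\mathbb{S}^3_2=\{x\in\mathbb{R}^4_2:\langle x,x\rangle=1\}$. An isometric immersion of $\mathbb{L}^2$ written as $f(u,v):\mathbb{R}^2\to\mathbb{H}^3_1$ means an immersion for which $\mathbb{R}^2$ with the induced metric is isometric to $\mathbb{L}^2$. $(u,v)$ are global characteristic parameters if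 there are $\omega_1(u),\omega_2(v)\in C^\infty(\mathbb{R})$ with $\omega_1(u)+\omega_2(v)\in(0,\pi)$ for all $(u,v)\in\mathbb{R}^2$ such that $$\langle df,df\rangle=-\cos(2\omega_1)du^2-2\cos(\omega_1-\omega_2)dudv-\cos(2\omega_2)dv^2,\quad -\langle df,dN\rangle=2\sin(\omega_1+\omega_2)dudv,$$ $$\langle dN,dN\rangle=\cos(2\omega_1)du^2-2\cos(\omega_1-\omega_2)dudv+\cos(2\omega_2)dv^2,$$ where $N$ is the unit normal of $f$ in $\mathbb{H}^3_1$ for which $\{f,f_u,f_v,N\}$ is a positively oriented basis of $\mathbb{R}^4_2$ (orientation of $\{1,i,j,k\}$) at every point. *)

(* Defs.v *)
From Stdlib Require Import Reals.
From Coquelicot Require Import Coquelicot.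
Open Scope R_scope.

(* [mkR42 x0 x1 x2 x3] is both the point (x0, x1, x2, x3) of R^4_2 and the element
   x0 + x1 i + x2 j + x3 k of the algebra. *)
Record R42 : Type := mkR42 { x0 : R; x1 : R; x2 : R; x3 : R }.

Declare Scope R42_scope.
Delimit Scope R42_scope with R42.
Bind Scope R42_scope with R42.

Definition q0 : R42 := mkR42 0 0 0 0.
Definition q1 : R42 := mkR42 1 0 0 0.
Definition qi : R42 := mkR42 0 1 0 0.
Definition qj : R42 := mkR42 0 0 1 0.
Definition qk : R42 := mkR42 0 0 0 1.

Definition qadd (x y : R42) : R42 :=
  mkR42 (x0 x + x0 y) (x1 x + x1 y) (x2 x + x2 y) (x3 x + x3 y).

Definition qscal (a : R) (x : R42) : R42 :=
  mkR42 (a * x0 x) (a * x1 x) (a * x2 x) (a * x3 x).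

(* Bilinear extension of the multiplication table recorded in [qmul_table]. *)
Definition qmul (x y : R42) : R42 :=
  mkR42 (x0 x * x0 y - x1 x * x1 y + x2 x * x2 y + x3 x * x3 y)
     (x0 x * x1 y + x1 x * x0 y - x2 x * x3 y + x3 x * x2 y)
     (x0 x * x2 y + x2 x * x0 y - x1 x * x3 y + x3 x * x1 y)
     (x0 x * x3 y + x3 x * x0 y + x1 x * x2 y - x2 x * x1 y).

Infix "+" := qadd : R42_scope.
Infix "*:" := qscal (at level 40) : R42_scope.
Infix "**" := qmul (at level 40, left associativity) : R42_scope.

Fact qmul_table :
  (qi ** qi = (-1) *: q1 /\ qj ** qj = q1 /\ qk ** qk = q1 /\
   qi ** qj = qk /\ qj ** qi = (-1) *: qk /\
   qi ** qk = (-1) *: qj /\ qk ** qi = qj /\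
   qj ** qk = (-1) *: qi /\ qk ** qj = qi /\
   forall x, q1 ** x = x /\ x ** q1 = x)%R42.
Proof.
repeat split; try (destruct x as [a b c d]);
  unfold qmul, qscal, q1, qi, qj, qk; simpl; f_equal; ring.
Qed.

Definition ip (x y : R42) : R :=
  - (x0 x * x0 y) - x1 x * x1 y + x2 x * x2 y + x3 x * x3 y.

Definition H31 (z : R42) : Prop := ip z z = -1.
Definition S32 (z : R42) : Prop := ip z z = 1.

Definition det3 (a1 a2 a3 b1 b2 b3 c1 c2 c3 : R) : R :=
  a1 * (b2 * c3 - b3 * c2) - a2 * (b1 * c3 - b3 * c1) + a3 * (b1 * c2 - b2 * c1).

(* Determinant of the 4x4 matrix with rows a, b, c, d. *)
Definition det4 (a b c d : R42) : R :=
    x0 a * det3 (x1 b) (x2 b) (x3 b) (x1 c) (x2 c) (x3 c) (x1 d) (x2 d) (x3 d)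
  - x1 a * det3 (x0 b) (x2 b) (x3 b) (x0 c) (x2 c) (x3 c) (x0 d) (x2 d) (x3 d)
  + x2 a * det3 (x0 b) (x1 b) (x3 b) (x0 c) (x1 c) (x3 c) (x0 d) (x1 d) (x3 d)
  - x3 a * det3 (x0 b) (x1 b) (x2 b) (x0 c) (x1 c) (x2 c) (x0 d) (x1 d) (x2 d).

Definition positively_oriented_basis (a b c d : R42) : Prop := 0 < det4 a b c d.

Definition smooth1 (w : R -> R) : Prop := forall n x, ex_derive_n w n x.

Definition smooth2 (g : R -> R -> R) : Prop := forall n u v, ex_diff_n g n u v.

Definition smooth2_R42 (f : R -> R -> R42) : Prop :=
  smooth2 (fun u v => x0 (f u v)) /\ smooth2 (fun u v => x1 (f u v)) /\
  smooth2 (fun u v => x2 (f u v)) /\ smooth2 (fun u v => x3 (f u v)).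

(* Velocity of a curve in R^4_2; meaningful only where the coordinates are
   differentiable, since [Derive] is total. *)
Definition velocity (c : R -> R42) (t : R) : R42 :=
  mkR42 (Derive (fun s => x0 (c s)) t) (Derive (fun s => x1 (c s)) t)
     (Derive (fun s => x2 (c s)) t) (Derive (fun s => x3 (c s)) t).

Definition partial_u (f : R -> R -> R42) (u v : R) : R42 :=
  velocity (fun s => f s v) u.
Definition partial_v (f : R -> R -> R42) (u v : R) : R42 :=
  velocity (fun s => f u s) v.

(* Differential at (u, v) applied to the tangent vector (du, dv). Quadratic
   differential forms such as <df, dN> are evaluated on such vectors. *)
Definition differential (f : R -> R -> R42) (u v du dv : R) : R42 :=
  (du *: partial_u f u v + dv *: partial_v f u v)%R42.

Definition differential_scalar (g : R -> R -> R) (u v du dv : R) : R :=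
  du * Derive (fun s => g s v) u + dv * Derive (fun s => g u s) v.

Definition immersion (f : R -> R -> R42) : Prop :=
  smooth2_R42 f /\
  forall u v du dv, differential f u v du dv = q0 -> du = 0 /\ dv = 0.

(* (p, q) : R^2 -> R^2 is a diffeomorphism, with inverse (r, s). *)
Definition diffeomorphism (p q : R -> R -> R) : Prop :=
  smooth2 p /\ smooth2 q /\
  exists r s : R -> R -> R,
    smooth2 r /\ smooth2 s /\
    (forall u v, r (p u v) (q u v) = u /\ s (p u v) (q u v) = v) /\
    (forall x y, p (r x y) (s x y) = x /\ q (r x y) (s x y) = y).

Definition induced_metric_isometric_to_L2 (f : R -> R -> R42) : Prop :=
  exists p q : R -> R -> R,
    diffeomorphism p q /\
    forall u v du dv,
      ip (differential f u v du dv) (differential f u v du dv) =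
      - (differential_scalar p u v du dv) ^ 2 + (differential_scalar q u v du dv) ^ 2.

Definition isometric_immersion_L2_H31 (f : R -> R -> R42) : Prop :=
  (forall u v, H31 (f u v)) /\ immersion f /\ induced_metric_isometric_to_L2 f.

(* Normality to f makes N tangent to [H31] along f. *)
Definition unit_normal (f N : R -> R -> R42) : Prop :=
  smooth2_R42 N /\
  (forall u v, S32 (N u v)) /\
  (forall u v, ip (N u v) (f u v) = 0) /\
  (forall u v du dv, ip (N u v) (differential f u v du dv) = 0) /\
  (forall u v,
     positively_oriented_basis (f u v) (partial_u f u v) (partial_v f u v) (N u v)).

Definition global_characteristic_parameters (f N : R -> R -> R42) : Prop :=
  exists w1 w2 : R -> R,
    smooth1 w1 /\ smooth1 w2 /\
    (forall u v, 0 < w1 u + w2 v < PI) /\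
    forall u v du dv,
      ip (differential f u v du dv) (differential f u v du dv) =
        - cos (2 * w1 u) * du ^ 2 - 2 * cos (w1 u - w2 v) * du * dv
        - cos (2 * w2 v) * dv ^ 2 /\
      - ip (differential f u v du dv) (differential N u v du dv) = 2 * sin (w1 u + w2 v) * du * dv /\
      ip (differential N u v du dv) (differential N u v du dv) =
        cos (2 * w1 u) * du ^ 2 - 2 * cos (w1 u - w2 v) * du * dv
        + cos (2 * w2 v) * dv ^ 2.

(* Main.v *)
Require Import Defs.
From Stdlib Require Import Reals Lra.
From Coquelicot Require Import Coquelicot.
Open Scope R_scope.

(** Write [c'] for the quaternionic conjugate of [c]; on [H31] it is the inverse.

    At each point [f, f_u, f_v, N] is a frame of [R42], and a vector is
    determined by its products with the four frame vectors.  Differentiating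
    the coefficients of the first and second fundamental forms gives the
    products of [f_uv], [N_u] and [N_v] with the frame.  On the other hand the
    triple product [a ** qconj b ** c] is expressed through [ip] and the volume
    form ([ip_triple]), and the Gram determinant together with the orientation
    gives [det4 f f_u f_v N = sin (w1 + w2)].  Comparing the two
    ([characteristic_equations]),

      [f_uv = f_u f' f_v],   [N_u = f_u f' N],   [N_v = N f' f_v].

    The first equation says that [f_u f'] does not depend on [v], the second
    that [f' N] does not depend on [u], and the third that [N f'] does not
    depend on [v] ([right_quotient_const], [left_quotient_const]).  Hence
    [f_u = a1_u a1' f], so [a1' f] does not depend on [u] and [f = a1 a2];
    moreover [N = j a2] on the line [u = 0], and then [N = f a2' j a2 = a1 j a2]
    everywhere.  The two orthogonality relations are [<f_u, N> = 0] on [v = 0]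
    and [<f_v, N> = 0] on [u = 0]. *)

(** * The algebra of [R42] *)

(** Conjugation, so that [x ** qconj x = - ip x x *: q1]. *)
Definition qconj (x : R42) : R42 := mkR42 (x0 x) (- x1 x) (- x2 x) (- x3 x).

Ltac coords :=
  intros; repeat match goal with x : R42 |- _ => destruct x end;
  unfold qadd, qscal, qmul, qconj, ip, det4, det3, q0, q1, qj;
  cbn [x0 x1 x2 x3].

Lemma R42_ext (x y : R42) :
  x0 x = x0 y -> x1 x = x1 y -> x2 x = x2 y -> x3 x = x3 y -> x = y.
Proof. destruct x, y; simpl; intros; f_equal; assumption. Qed.

Ltac qring := coords; apply R42_ext; cbn [x0 x1 x2 x3]; ring.

Lemma qmulA (x y z : R42) : (x ** (y ** z) = x ** y ** z)%R42.
Proof. qring. Qed.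

Lemma qmul1l (x : R42) : (q1 ** x = x)%R42.
Proof. qring. Qed.

Lemma qmul1r (x : R42) : (x ** q1 = x)%R42.
Proof. qring. Qed.

Lemma qconj1 : qconj q1 = q1.
Proof. qring. Qed.

Lemma qmul_conj_r (x : R42) : (x ** qconj x = (- ip x x) *: q1)%R42.
Proof. qring. Qed.

Lemma qmul_conj_l (x : R42) : (qconj x ** x = (- ip x x) *: q1)%R42.
Proof. qring. Qed.

Lemma H31_conj_r (x : R42) : H31 x -> (x ** qconj x = q1)%R42.
Proof. intros H; rewrite qmul_conj_r, H; qring. Qed.

Lemma H31_conj_l (x : R42) : H31 x -> (qconj x ** x = q1)%R42.
Proof. intros H; rewrite qmul_conj_l, H; qring. Qed.

Lemma ipC (x y : R42) : ip x y = ip y x.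
Proof. coords; ring. Qed.

(** The part of the triple product not accounted for by inner products is the
    vector product of the three factors. *)
Lemma ip_triple (a b c d : R42) :
  ip (a ** qconj b ** c)%R42 d =
  - ip a b * ip c d - ip b c * ip a d + ip a c * ip b d - det4 a b c d.
Proof. coords; ring. Qed.

(** No sign appears because the metric of [R42] has determinant [1]. *)
Lemma det4_gram (a b c d : R42) :
  det4 a b c d ^ 2 =
  det4 (mkR42 (ip a a) (ip a b) (ip a c) (ip a d))
       (mkR42 (ip b a) (ip b b) (ip b c) (ip b d))
       (mkR42 (ip c a) (ip c b) (ip c c) (ip c d))
       (mkR42 (ip d a) (ip d b) (ip d c) (ip d d)).
Proof. coords; ring. Qed.

(** A vector is determined by its products with a basis. *)
Lemma frame_ext (a b c d w w' : R42) :
  det4 a b c d <> 0 ->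
  ip w a = ip w' a -> ip w b = ip w' b -> ip w c = ip w' c -> ip w d = ip w' d ->
  w = w'.
Proof.
intros Hdet Ha Hb Hc Hd.
(* Cramer's rule: the i-th column is replaced by the products with w. *)
assert (C : forall z,
  det4 a b c d * x0 z =
    - det4 (mkR42 (ip z a) (x1 a) (x2 a) (x3 a)) (mkR42 (ip z b) (x1 b) (x2 b) (x3 b))
           (mkR42 (ip z c) (x1 c) (x2 c) (x3 c)) (mkR42 (ip z d) (x1 d) (x2 d) (x3 d)) /\
  det4 a b c d * x1 z =
    - det4 (mkR42 (x0 a) (ip z a) (x2 a) (x3 a)) (mkR42 (x0 b) (ip z b) (x2 b) (x3 b))
           (mkR42 (x0 c) (ip z c) (x2 c) (x3 c)) (mkR42 (x0 d) (ip z d) (x2 d) (x3 d)) /\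
  det4 a b c d * x2 z =
    det4 (mkR42 (x0 a) (x1 a) (ip z a) (x3 a)) (mkR42 (x0 b) (x1 b) (ip z b) (x3 b))
         (mkR42 (x0 c) (x1 c) (ip z c) (x3 c)) (mkR42 (x0 d) (x1 d) (ip z d) (x3 d)) /\
  det4 a b c d * x3 z =
    det4 (mkR42 (x0 a) (x1 a) (x2 a) (ip z a)) (mkR42 (x0 b) (x1 b) (x2 b) (ip z b))
         (mkR42 (x0 c) (x1 c) (x2 c) (ip z c)) (mkR42 (x0 d) (x1 d) (x2 d) (ip z d))).
{ clear; intros z; repeat split; coords; ring. }
destruct (C w) as (C0 & C1 & C2 & C3), (C w') as (D0 & D1 & D2 & D3).
rewrite Ha, Hb, Hc, Hd in C0, C1, C2, C3.
apply R42_ext; apply (Rmult_eq_reg_l _ _ _) with (2 := Hdet); congruence.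
Qed.

(** * Curves in [R42] *)

(** The curve [c] is differentiable at [t], with velocity [l]. *)
Definition has_velocity (c : R -> R42) (t : R) (l : R42) : Prop :=
  is_derive (fun s => x0 (c s)) t (x0 l) /\ is_derive (fun s => x1 (c s)) t (x1 l) /\
  is_derive (fun s => x2 (c s)) t (x2 l) /\ is_derive (fun s => x3 (c s)) t (x3 l).

Lemma is_derive_zero_const (g : R -> R) :
  (forall t, is_derive g t 0) -> forall s t, g s = g t.
Proof.
intros H s t; destruct (Rtotal_order s t) as [L | [-> | L]].
- apply eq_is_derive; [intros; apply H | exact L].
- reflexivity.
- symmetry; apply eq_is_derive; [intros; apply H | exact L].
Qed.

Lemma velocity_zero_const (c : R -> R42) :
  (forall t, has_velocity c t q0) -> forall s t, c s = c t.
Proof.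
intros H s t; apply R42_ext.
- exact (is_derive_zero_const _ (fun r => proj1 (H r)) s t).
- exact (is_derive_zero_const _ (fun r => proj1 (proj2 (H r))) s t).
- exact (is_derive_zero_const _ (fun r => proj1 (proj2 (proj2 (H r)))) s t).
- exact (is_derive_zero_const _ (fun r => proj2 (proj2 (proj2 (H r)))) s t).
Qed.

Lemma is_derive_Rmult (g h : R -> R) (t l m : R) :
  is_derive g t l -> is_derive h t m ->
  is_derive (fun s => g s * h s) t (l * h t + g t * m).
Proof. intros G H; exact (is_derive_mult g h t l m G H Rmult_comm). Qed.

(** Reduces [is_derive] for a polynomial expression in given functions to their
    [is_derive] hypotheses. *)
Ltac derive_step :=
  first
  [ eassumption
  | lazymatch goal with
    | |- is_derive (fun s => @?a s + @?b s) _ _ => apply (is_derive_plus a b)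
    | |- is_derive (fun s => @?a s - @?b s) _ _ => apply (is_derive_minus a b)
    | |- is_derive (fun s => - @?a s) _ _ => apply (is_derive_opp a)
    | |- is_derive (fun s => @?a s * @?b s) _ _ => apply (is_derive_Rmult a b)
    end ].

Ltac derive_poly :=
  evar_last;
  [ repeat derive_step
  | unfold minus, plus, opp; simpl; ring ].

Lemma is_derive_ip (c d : R -> R42) (t : R) (l m : R42) :
  has_velocity c t l -> has_velocity d t m ->
  is_derive (fun s => ip (c s) (d s)) t (ip l (d t) + ip (c t) m).
Proof.
intros (A0 & A1 & A2 & A3) (B0 & B1 & B2 & B3); unfold ip; derive_poly.
Qed.

Lemma has_velocity_mul (c d : R -> R42) (t : R) (l m : R42) :
  has_velocity c t l -> has_velocity d t m ->
  has_velocity (fun s => c s ** d s)%R42 t (l ** d t + c t ** m)%R42.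
Proof.
intros (A0 & A1 & A2 & A3) (B0 & B1 & B2 & B3).
refine (conj _ (conj _ (conj _ _))); cbn [x0 x1 x2 x3 qmul qadd]; derive_poly.
Qed.

Lemma has_velocity_conj (c : R -> R42) (t : R) (l : R42) :
  has_velocity c t l -> has_velocity (fun s => qconj (c s)) t (qconj l).
Proof.
intros (A0 & A1 & A2 & A3); refine (conj _ (conj _ (conj _ _))); cbn [x0 x1 x2 x3 qconj]; derive_poly.
Qed.

(** A constant inner product has zero derivative. *)
Lemma ip_const_derive (c d : R -> R42) (k t : R) (l m : R42) :
  (forall s, ip (c s) (d s) = k) ->
  has_velocity c t l -> has_velocity d t m ->
  ip l (d t) + ip (c t) m = 0.
Proof.
intros Hk Hc Hd.
transitivity (Derive (fun s => ip (c s) (d s)) t).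
{ symmetry; apply is_derive_unique, is_derive_ip; assumption. }
rewrite (Derive_ext _ (fun _ => k) t Hk); apply Derive_const.
Qed.

(** If [c = x d] with [d] in [H31], then [x = c ** qconj d], and this is
    constant exactly when [c] solves the linear equation below. *)
Lemma right_quotient_const (c d l m : R -> R42) :
  (forall t, H31 (d t)) ->
  (forall t, has_velocity c t (l t)) -> (forall t, has_velocity d t (m t)) ->
  (forall t, l t = c t ** qconj (d t) ** m t)%R42 ->
  forall s t, (c s ** qconj (d s) = c t ** qconj (d t))%R42.
Proof.
intros Hd Hc Hm Hl.
apply (velocity_zero_const (fun s => c s ** qconj (d s))%R42); intros t.
assert (O : ip (d t) (m t) = 0).
{ pose proof (ip_const_derive d d (-1) t _ _ Hd (Hm t) (Hm t)) as E.
  rewrite (ipC (m t)) in E; lra. }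
replace q0 with (l t ** qconj (d t) + c t ** qconj (m t))%R42.
{ exact (has_velocity_mul _ _ _ _ _ (Hc t) (has_velocity_conj _ _ _ (Hm t))). }
rewrite Hl.
(* d' m d' = - m', since m is orthogonal to d. *)
assert (E : (qconj (d t) ** m t ** qconj (d t) = (-1) *: qconj (m t))%R42).
{ transitivity ((-2 * ip (d t) (m t)) *: qconj (d t) + ip (d t) (d t) *: qconj (m t))%R42.
  - qring.
  - rewrite O, (Hd t); qring. }
replace (c t ** qconj (d t) ** m t ** qconj (d t))%R42
  with (c t ** (qconj (d t) ** m t ** qconj (d t)))%R42 by (rewrite !qmulA; reflexivity).
rewrite E; qring.
Qed.

(** The mirror image of [right_quotient_const], obtained by conjugating. *)
Lemma left_quotient_const (c d l m : R -> R42) :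
  (forall t, H31 (d t)) ->
  (forall t, has_velocity c t (l t)) -> (forall t, has_velocity d t (m t)) ->
  (forall t, l t = m t ** qconj (d t) ** c t)%R42 ->
  forall s t, (qconj (d s) ** c s = qconj (d t) ** c t)%R42.
Proof.
intros Hd Hc Hm Hl s t.
assert (KM : forall x y, qconj (qconj x ** y)%R42 = (qconj y ** qconj (qconj x))%R42)
  by qring.
assert (K : forall x, qconj (qconj x) = x) by qring.
rewrite <- (K (qconj (d s) ** c s)%R42), <- (K (qconj (d t) ** c t)%R42).
f_equal; rewrite !KM.
apply (right_quotient_const (fun r => qconj (c r)) (fun r => qconj (d r))
         (fun r => qconj (l r)) (fun r => qconj (m r))).
- intros r; unfold H31; rewrite <- (Hd r); coords; ring.
- intros r; apply has_velocity_conj, Hc.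
- intros r; apply has_velocity_conj, Hm.
- intros r; rewrite Hl; qring.
Qed.

(** * Smooth maps of the plane into [R42] *)

Lemma smooth2_Derive_u (g : R -> R -> R) :
  smooth2 g -> smooth2 (fun u v => Derive (fun s => g s v) u).
Proof. intros H n u v; exact (proj1 (proj2 (proj2 (proj2 (H (S n) u v))))). Qed.

Lemma smooth2_Derive_v (g : R -> R -> R) :
  smooth2 g -> smooth2 (fun u v => Derive (fun s => g u s) v).
Proof. intros H n u v; exact (proj2 (proj2 (proj2 (proj2 (H (S n) u v))))). Qed.

Lemma smooth2_is_derive_u (g : R -> R -> R) (u v : R) :
  smooth2 g -> is_derive (fun s => g s v) u (Derive (fun s => g s v) u).
Proof. intros H; apply Derive_correct; exact (proj1 (proj2 (H 1%nat u v))). Qed.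

Lemma smooth2_is_derive_v (g : R -> R -> R) (u v : R) :
  smooth2 g -> is_derive (fun s => g u s) v (Derive (fun s => g u s) v).
Proof. intros H; apply Derive_correct; exact (proj1 (proj2 (proj2 (H 1%nat u v)))). Qed.

Lemma smooth2_continuous (g : R -> R -> R) (u v : R) :
  smooth2 g -> continuity_2d_pt g u v.
Proof. intros H; exact (proj1 (H 0%nat u v)). Qed.

Lemma smooth2_Schwarz (g : R -> R -> R) (u v : R) :
  smooth2 g ->
  Derive (fun s => Derive (fun t => g s t) v) u =
  Derive (fun s => Derive (fun t => g t s) u) v.
Proof.
intros H; apply Schwarz.
- apply locally_2d_forall; intros x y; repeat split; eexists.
  + apply smooth2_is_derive_u, H.
  + apply smooth2_is_derive_v, H.
  + apply (smooth2_is_derive_u (fun a b => Derive (fun t => g a t) b)).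
    apply smooth2_Derive_v, H.
  + apply (smooth2_is_derive_v (fun a b => Derive (fun t => g t b) a)).
    apply smooth2_Derive_u, H.
- apply (smooth2_continuous (fun x y => Derive (fun z => Derive (fun t => g z t) y) x)).
  apply (smooth2_Derive_u (fun x y => Derive (fun t => g x t) y)), smooth2_Derive_v, H.
- apply (smooth2_continuous (fun x y => Derive (fun z => Derive (fun t => g t z) x) y)).
  apply (smooth2_Derive_v (fun x y => Derive (fun t => g t y) x)), smooth2_Derive_u, H.
Qed.

Lemma smooth2_R42_partial_u (f : R -> R -> R42) :
  smooth2_R42 f -> smooth2_R42 (partial_u f).
Proof.
intros (H0 & H1 & H2 & H3).
exact (conj (smooth2_Derive_u _ H0) (conj (smooth2_Derive_u _ H1)
  (conj (smooth2_Derive_u _ H2) (smooth2_Derive_u _ H3)))).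
Qed.

Lemma smooth2_R42_partial_v (f : R -> R -> R42) :
  smooth2_R42 f -> smooth2_R42 (partial_v f).
Proof.
intros (H0 & H1 & H2 & H3).
exact (conj (smooth2_Derive_v _ H0) (conj (smooth2_Derive_v _ H1)
  (conj (smooth2_Derive_v _ H2) (smooth2_Derive_v _ H3)))).
Qed.

Lemma has_velocity_u (f : R -> R -> R42) (u v : R) :
  smooth2_R42 f -> has_velocity (fun s => f s v) u (partial_u f u v).
Proof.
intros (H0 & H1 & H2 & H3).
exact (conj (smooth2_is_derive_u _ u v H0) (conj (smooth2_is_derive_u _ u v H1)
  (conj (smooth2_is_derive_u _ u v H2) (smooth2_is_derive_u _ u v H3)))).
Qed.

Lemma has_velocity_v (f : R -> R -> R42) (u v : R) :
  smooth2_R42 f -> has_velocity (fun s => f u s) v (partial_v f u v).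
Proof.
intros (H0 & H1 & H2 & H3).
exact (conj (smooth2_is_derive_v _ u v H0) (conj (smooth2_is_derive_v _ u v H1)
  (conj (smooth2_is_derive_v _ u v H2) (smooth2_is_derive_v _ u v H3)))).
Qed.

Lemma partial_comm (f : R -> R -> R42) (u v : R) :
  smooth2_R42 f ->
  partial_u (partial_v f) u v = partial_v (partial_u f) u v.
Proof.
intros (H0 & H1 & H2 & H3).
apply R42_ext.
- exact (smooth2_Schwarz _ u v H0).
- exact (smooth2_Schwarz _ u v H1).
- exact (smooth2_Schwarz _ u v H2).
- exact (smooth2_Schwarz _ u v H3).
Qed.

Lemma differential_10 (f : R -> R -> R42) (u v : R) :
  Defs.differential f u v 1 0 = partial_u f u v.
Proof.
unfold Defs.differential; generalize (partial_u f u v) (partial_v f u v); qring.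
Qed.

Lemma differential_01 (f : R -> R -> R42) (u v : R) :
  Defs.differential f u v 0 1 = partial_v f u v.
Proof.
unfold Defs.differential; generalize (partial_u f u v) (partial_v f u v); qring.
Qed.

Lemma ip_differential (f g : R -> R -> R42) (u v a b : R) :
  ip (Defs.differential f u v a b) (Defs.differential g u v a b) =
  a ^ 2 * ip (partial_u f u v) (partial_u g u v)
  + a * b * (ip (partial_u f u v) (partial_v g u v)
             + ip (partial_v f u v) (partial_u g u v))
  + b ^ 2 * ip (partial_v f u v) (partial_v g u v).
Proof.
unfold Defs.differential.
generalize (partial_u f u v) (partial_v f u v) (partial_u g u v) (partial_v g u v).
coords; ring.
Qed.

(** * The structure equations in characteristic parameters *)

Lemma quadratic_form_coeff (A B C A' B' C' : R) :
  (forall x y, x ^ 2 * A + x * y * B + y ^ 2 * C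
               = x ^ 2 * A' + x * y * B' + y ^ 2 * C') ->
  A = A' /\ B = B' /\ C = C'.
Proof.
intros H; pose proof (H 1 0); pose proof (H 0 1); pose proof (H 1 1); lra.
Qed.

Lemma cos_det (a b : R) :
  cos (a - b) ^ 2 - cos (2 * a) * cos (2 * b) = sin (a + b) ^ 2.
Proof.
rewrite cos_minus, sin_plus, !cos_2a; ring.
Qed.

(** The equations of Gauss and Weingarten, written with the product of the
    algebra instead of Christoffel symbols. *)
Lemma characteristic_equations (f N : R -> R -> R42) :
  smooth2_R42 f -> (forall u v, H31 (f u v)) ->
  unit_normal f N -> global_characteristic_parameters f N ->
  forall u v,
    (partial_v (partial_u f) u v =
       partial_u f u v ** qconj (f u v) ** partial_v f u v /\
     partial_u N u v = partial_u f u v ** qconj (f u v) ** N u v /\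
     partial_v N u v = N u v ** qconj (f u v) ** partial_v f u v)%R42.
Proof.
intros Sf Hf (SN & HN & HNf & HNdf & Hor) (w1 & w2 & _ & _ & Hw & Hforms).
assert (I : forall u v,
  ip (partial_u f u v) (partial_u f u v) = - cos (2 * w1 u) /\
  ip (partial_u f u v) (partial_v f u v) = - cos (w1 u - w2 v) /\
  ip (partial_v f u v) (partial_v f u v) = - cos (2 * w2 v)).
{ intros u v.
  destruct (quadratic_form_coeff (ip (partial_u f u v) (partial_u f u v))
    (ip (partial_u f u v) (partial_v f u v) + ip (partial_v f u v) (partial_u f u v))
    (ip (partial_v f u v) (partial_v f u v))
    (- cos (2 * w1 u)) (- 2 * cos (w1 u - w2 v)) (- cos (2 * w2 v)))
    as (E1 & E2 & E3).
  - intros a b; rewrite <- ip_differential, (proj1 (Hforms u v a b)); ring.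
  - rewrite (ipC (partial_v f u v)) in E2; lra. }
assert (II : forall u v,
  ip (partial_u f u v) (partial_u N u v) = 0 /\
  ip (partial_u f u v) (partial_v N u v) + ip (partial_v f u v) (partial_u N u v)
    = - 2 * sin (w1 u + w2 v) /\
  ip (partial_v f u v) (partial_v N u v) = 0).
{ intros u v; apply quadratic_form_coeff; intros a b.
  rewrite <- ip_differential.
  pose proof (proj1 (proj2 (Hforms u v a b))); lra. }
assert (Nu : forall u v, ip (partial_u f u v) (N u v) = 0).
{ intros u v; rewrite ipC, <- differential_10; apply HNdf. }
assert (Nv : forall u v, ip (partial_v f u v) (N u v) = 0).
{ intros u v; rewrite ipC, <- differential_01; apply HNdf. }
pose proof (smooth2_R42_partial_u f Sf) as Sfu.
pose proof (smooth2_R42_partial_v f Sf) as Sfv.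
assert (fu : forall u v, ip (partial_u f u v) (f u v) = 0).
{ intros u v.
  pose proof (ip_const_derive (fun s => f s v) (fun s => f s v) (-1) u _ _
    (fun s => Hf s v) (has_velocity_u f u v Sf) (has_velocity_u f u v Sf)) as E.
  cbv beta in E; rewrite (ipC (f u v)) in E; lra. }
assert (fv : forall u v, ip (partial_v f u v) (f u v) = 0).
{ intros u v.
  pose proof (ip_const_derive (f u) (f u) (-1) v _ _
    (Hf u) (has_velocity_v f u v Sf) (has_velocity_v f u v Sf)) as E.
  rewrite (ipC (f u v)) in E; lra. }
intros u v.
destruct (I u v) as (E & F & G), (II u v) as (L & M & P).
pose proof (fu u v) as Hfu; pose proof (fv u v) as Hfv.
pose proof (Nu u v) as HNu; pose proof (Nv u v) as HNv.
pose proof (Hf u v) as Hff; unfold H31 in Hff.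
pose proof (HN u v) as HNN; unfold S32 in HNN.
pose proof (HNf u v) as HNf'; rewrite ipC in HNf'.
(* The inner products of the frame vectors found so far are constant along the
   relevant coordinate lines; differentiating them gives the products of the
   mixed second derivative X, of N_u and of N_v with the frame. *)
set (X := partial_v (partial_u f) u v).
assert (Xf : ip X (f u v) + ip (partial_u f u v) (partial_v f u v) = 0).
{ apply (ip_const_derive (partial_u f u) (f u) 0 v).
  - apply fu.
  - apply has_velocity_v, Sfu.
  - apply has_velocity_v, Sf. }
assert (Xu : ip X (partial_u f u v) = 0).
{ assert (T : ip X (partial_u f u v) + ip (partial_u f u v) X = 0).
  { apply (ip_const_derive (partial_u f u) (partial_u f u) (- cos (2 * w1 u)) v).
    - intros s; apply (I u s).
    - apply has_velocity_v, Sfu.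
    - apply has_velocity_v, Sfu. }
  rewrite (ipC _ X) in T; lra. }
assert (Xv : ip X (partial_v f u v) = 0).
{ assert (T : ip X (partial_v f u v) + ip (partial_v f u v) X = 0).
  { unfold X; rewrite <- (partial_comm f u v Sf).
    apply (ip_const_derive (fun s => partial_v f s v) (fun s => partial_v f s v)
             (- cos (2 * w2 v)) u).
    - intros s; apply (I s v).
    - apply (has_velocity_u (partial_v f)), Sfv.
    - apply (has_velocity_u (partial_v f)), Sfv. }
  rewrite (ipC _ X) in T; lra. }
assert (XN1 : ip X (N u v) + ip (partial_u f u v) (partial_v N u v) = 0).
{ apply (ip_const_derive (partial_u f u) (N u) 0 v).
  - apply Nu.
  - apply has_velocity_v, Sfu.
  - apply has_velocity_v, SN. }
assert (XN2 : ip X (N u v) + ip (partial_v f u v) (partial_u N u v) = 0).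
{ unfold X; rewrite <- (partial_comm f u v Sf).
  apply (ip_const_derive (fun s => partial_v f s v) (fun s => N s v) 0 u).
  - intros s; apply Nv.
  - apply (has_velocity_u (partial_v f)), Sfv.
  - apply has_velocity_u, SN. }
assert (Nuf : ip (partial_u N u v) (f u v) + ip (N u v) (partial_u f u v) = 0).
{ apply (ip_const_derive (fun s => N s v) (fun s => f s v) 0 u).
  - intros s; apply HNf.
  - apply has_velocity_u, SN.
  - apply has_velocity_u, Sf. }
assert (Nvf : ip (partial_v N u v) (f u v) + ip (N u v) (partial_v f u v) = 0).
{ apply (ip_const_derive (N u) (f u) 0 v).
  - apply HNf.
  - apply has_velocity_v, SN.
  - apply has_velocity_v, Sf. }
assert (NuN : ip (partial_u N u v) (N u v) + ip (N u v) (partial_u N u v) = 0).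
{ apply (ip_const_derive (fun s => N s v) (fun s => N s v) 1 u).
  - intros s; apply HN.
  - apply has_velocity_u, SN.
  - apply has_velocity_u, SN. }
assert (NvN : ip (partial_v N u v) (N u v) + ip (N u v) (partial_v N u v) = 0).
{ apply (ip_const_derive (N u) (N u) 1 v).
  - apply HN.
  - apply has_velocity_v, SN.
  - apply has_velocity_v, SN. }
assert (Sin : 0 < sin (w1 u + w2 v)) by (apply sin_gt_0; apply Hw).
pose proof (Hor u v) as D; unfold positively_oriented_basis in D.
assert (Det : det4 (f u v) (partial_u f u v) (partial_v f u v) (N u v)
              = sin (w1 u + w2 v)).
{ apply Rsqr_inj; [lra | lra |].
  rewrite !Rsqr_pow2, det4_gram, <- cos_det.
  rewrite (ipC (f u v) (partial_u f u v)), (ipC (f u v) (partial_v f u v)),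
    (ipC (partial_v f u v) (partial_u f u v)), (ipC (N u v) (f u v)),
    (ipC (N u v) (partial_u f u v)), (ipC (N u v) (partial_v f u v)).
  rewrite Hff, HNN, E, F, G, Hfu, Hfv, HNu, HNv, HNf'.
  coords; ring. }
clear - Hff HNN E F G Hfu Hfv HNu HNv HNf' Xf Xu Xv XN1 XN2 Nuf Nvf NuN NvN Sin Det L M P.
clearbody X.
revert Hff HNN E F G Hfu Hfv HNu HNv HNf' Xf Xu Xv XN1 XN2 Nuf Nvf NuN NvN Sin Det L M P.
generalize (partial_u N u v) (partial_v N u v) (sin (w1 u + w2 v))
  (f u v) (partial_u f u v) (partial_v f u v) (N u v).
intros nu nv s p a b n; intros.
(* The volume form on the triples of frame vectors that occur below. *)
assert (Z1 : forall x y z, det4 x y z x = 0) by (clear; coords; ring).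
assert (Z2 : forall x y z, det4 y x z x = 0) by (clear; coords; ring).
assert (Z3 : forall x y z, det4 y z x x = 0) by (clear; coords; ring).
assert (D1 : det4 a p b n = - s) by (rewrite <- Det; clear; coords; ring).
assert (D2 : det4 a p n b = s) by (rewrite <- Det; clear; coords; ring).
assert (D3 : det4 n p b a = s) by (rewrite <- Det; clear; coords; ring).
assert (HD : det4 p a b n <> 0) by lra.
rewrite (ipC n) in Nuf, Nvf, NuN, NvN.
rewrite (ipC a nu) in L; rewrite (ipC b nv) in P.
rewrite (ipC a nv), (ipC b nu) in M; rewrite (ipC a nv) in XN1; rewrite (ipC b nu) in XN2.
repeat split; apply (frame_ext p a b n _ _ HD);
  rewrite ip_triple, ?Z1, ?Z2, ?Z3, ?D1, ?D2, ?D3, ?(ipC p a), ?(ipC p b), ?(ipC n p),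
    ?(ipC b a), ?(ipC n a), ?(ipC n b), ?Hff, ?HNN, ?Hfu, ?Hfv, ?HNu, ?HNv, ?HNf';
  lra.
Qed.

(** * The product decomposition *)

Theorem theorem8 (f N : R -> R -> R42)
    (Hf : isometric_immersion_L2_H31 f)
    (HN : unit_normal f N)
    (Huv : global_characteristic_parameters f N)
    (Hf0 : f 0 0 = q1)
    (HN0 : N 0 0 = qj) :
  let a1 := fun u : R => f u 0 in
  let a2 := fun v : R => f 0 v in
  (forall u v : R,
     f u v = (a1 u ** a2 v)%R42 /\ N u v = (a1 u ** qj ** a2 v)%R42) /\
  (forall u : R, ip (velocity a1 u) (a1 u ** qj)%R42 = 0) /\
  (forall v : R, ip (velocity a2 v) (qj ** a2 v)%R42 = 0).
Proof.
intros a1 a2.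
destruct Hf as (Hf & (Sf & _) & _).
pose proof (characteristic_equations f N Sf Hf HN Huv) as Eq.
destruct HN as (SN & _ & _ & HNdf & _).
(* f_u f' does not depend on v. *)
assert (Fu : forall u v, partial_u f u v = (partial_u f u 0 ** qconj (a1 u) ** f u v)%R42).
{ intros u v.
  unfold a1; rewrite (right_quotient_const (partial_u f u) (f u)
    (partial_v (partial_u f) u) (partial_v f u)) with (t := v).
  - rewrite <- qmulA, (H31_conj_l _ (Hf u v)), qmul1r; reflexivity.
  - intros t; apply Hf.
  - intros t; apply has_velocity_v, smooth2_R42_partial_u, Sf.
  - intros t; apply has_velocity_v, Sf.
  - intros t; apply Eq. }
assert (Ff : forall u v, f u v = (a1 u ** a2 v)%R42).
{ intros u v.
  assert (C : (qconj (a1 u) ** f u v = qconj (a1 0) ** f 0 v)%R42).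
  { apply (left_quotient_const (fun s => f s v) a1
      (fun s => partial_u f s v) (fun s => partial_u f s 0)).
    - intros t; apply Hf.
    - intros t; apply has_velocity_u, Sf.
    - intros t; apply has_velocity_u, Sf.
    - intros t; apply Fu. }
  unfold a1 in C at 2; rewrite Hf0, qconj1, qmul1l in C.
  unfold a2; rewrite <- C, qmulA, (H31_conj_r (a1 u) (Hf u 0)), qmul1l; reflexivity. }
assert (N0 : forall v, N 0 v = (qj ** a2 v)%R42).
{ intros v.
  assert (C : (N 0 v ** qconj (f 0 v) = N 0 0 ** qconj (f 0 0))%R42).
  { apply (right_quotient_const (N 0) (f 0) (partial_v N 0) (partial_v f 0)).
    - intros t; apply Hf.
    - intros t; apply has_velocity_v, SN.
    - intros t; apply has_velocity_v, Sf.
    - intros t; apply Eq. }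
  rewrite Hf0, HN0, qconj1, qmul1r in C.
  rewrite <- C; unfold a2.
  rewrite <- qmulA, (H31_conj_l _ (Hf 0 v)), qmul1r; reflexivity. }
assert (FN : forall u v, N u v = (a1 u ** qj ** a2 v)%R42).
{ intros u v.
  assert (C : (qconj (f u v) ** N u v = qconj (f 0 v) ** N 0 v)%R42).
  { apply (left_quotient_const (fun s => N s v) (fun s => f s v)
      (fun s => partial_u N s v) (fun s => partial_u f s v)).
    - intros t; apply Hf.
    - intros t; apply has_velocity_u, SN.
    - intros t; apply has_velocity_u, Sf.
    - intros t; apply Eq. }
  transitivity (f u v ** (qconj (f u v) ** N u v))%R42.
  - rewrite qmulA, (H31_conj_r _ (Hf u v)), qmul1l; reflexivity.
  - rewrite C, N0, Ff, !qmulA.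
    rewrite <- (qmulA (a1 u) (a2 v)); unfold a2 at 1.
    rewrite (H31_conj_r _ (Hf 0 v)), qmul1r; reflexivity. }
split; [intros u v; split; [apply Ff | apply FN] | split].
- intros u.
  assert (H : (a1 u ** qj = N u 0)%R42)
    by (rewrite FN; unfold a2; rewrite Hf0, qmul1r; reflexivity).
  rewrite H, ipC; change (velocity a1 u) with (partial_u f u 0).
  rewrite <- differential_10; apply HNdf.
- intros v.
  rewrite <- N0, ipC; change (velocity a2 v) with (partial_v f 0 v).
  rewrite <- differential_01; apply HNdf.
Qed.
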